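(* Let $\mathcal{X}=\mathbb{R}^d$ with $d\ge 1$. There is a universal constant $c>0$ such that for every $\epsilon>0$ and every integer $K\ge 2$ there exist a label set $\mathcal{Y}=[M]$ with $|\mathcal{Y}|=M\le K$ and a finite class $\mathcal{F}$ of size $K$ of functions $f:\mathcal{X}\to\mathcal{D}(\mathcal{Y})$ such that, for every integer $T\ge \frac{K}{9\min\{(e^\epsilon-1)^2,1\}e^{\epsilon}}$, every $(\epsilon,0)$-locally differentially private privatization scheme $\mathcal{R}^T$ and every prediction scheme $\Phi^T$ (both of which may depend on $\mathcal{F}$) satisfy $$\sup_{f\in\mathcal{F},\,\mathbf{x}^T\in\mathcal{X}^T}\mathbb{E}\left[\sum_{t=1}^T\mathsf{KL}(f(\mathbf{x}_t),\hat p_t)\right]\ \ge\ c\,\sqrt{\frac{KT}{\min\{(e^\epsilon-1)^2,1\}\,e^{\epsilon}}}\,,$$ i.e. the minimax KL-risk $r_T^{\mathsf{KL}}(\mathcal{F})$ under $(\epsilon,0)$-local differential privacy is $\Omega\Big(\sqrt{\tfrac{KT}{\min\{(e^\epsilon-1)^2,1\}e^\epsilon}}\Big)$. Moreover, for all sufficiently small $\epsilon$ (smaller than a universal constant) and $T$ in the same range, this lower bound is $\Omega\big(\frac{1}{\epsilon}\sqrt{KT}\big)$.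
   Context: Setting (private online conditional distribution learning). $\mathcal{X}=\mathbb{R}^d$ is the feature space, $\mathcal{Y}=[M]=\{1,\dots,M\}$ the label set, and $\mathcal{D}(\mathcal{Y})$ the set of probability distributions on $\mathcal{Y}$. $\mathcal{F}=\{f_1,\dots,f_K\}$ is a class of functions $f_j:\mathcal{X}\to\mathcal{D}(\mathcal{Y})$, known to all parties. Nature picks an unknown $f\in\mathcal{F}$ and a feature sequence $\mathbf{x}^T=(\mathbf{x}_1,\dots,\mathbf{x}_T)\in\mathcal{X}^T$. At each time $t=1,\dots,T$: $\mathbf{x}_t$ is revealed; the learner outputs $\hat p_t=\Phi_t(\mathbf{x}^t,\tilde{\mathbf{Y}}^{t-1})\in\mathcal{D}(\mathcal{Y})$, where $\mathbf{x}^t=(\mathbf{x}_1,\dots,\mathbf{x}_t)$ and $\tilde{\mathbf{Y}}^{t-1}=(\tilde{\mathbf{Y}}_1,\dots,\tilde{\mathbf{Y}}_{t-1})$; then a user samples $Y_t\sim f(\mathbf{x}_t)$ independently over $t$ and reveals only $\tilde{\mathbf{Y}}_t=\mathcal{R}_t(Y_t)\in\mathbb{R}^K$, where $\mathcal{R}_t$ is a randomized map from $\mathcal{Y}$ to $\mathbb{R}^K$ which may depend on $\mathcal{F}$, $T$ and $\mathbf{x}_t$, with internal randomness independent across different $t$. A prediction scheme is $\Phi^T=(\Phi_1,\dots,\Phi_T)$ and a privatization scheme is $\mathcal{R}^T=(\mathcal{R}_1,\dots,\mathcal{R}_T)$. $\mathcal{R}^T$ is $(\epsilon,\delta)$-locally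 differentially private if for every $t$, every $y,y'\in\mathcal{Y}$ and every measurable $S\subseteq\mathbb{R}^K$, $\Pr(\mathcal{R}_t(y)\in S)\le e^\epsilon\Pr(\mathcal{R}_t(y')\in S)+\delta$; $\mathcal{L}(\epsilon,\delta)$ denotes the set of such schemes. $\mathsf{KL}(p_1,p_2)=\sum_{y\in\mathcal{Y}}p_1[y]\log\frac{p_1[y]}{p_2[y]}$ (possibly $+\infty$). The minimax KL-risk is $$r_T^{\mathsf{KL}}(\mathcal{F})=\inf_{\mathcal{R}^T\in\mathcal{L}(\epsilon,\delta),\,\Phi^T}\ \sup_{f\in\mathcal{F},\,\mathbf{x}^T\in\mathcal{X}^T}\mathbb{E}_{\tilde{\mathbf{Y}}^T}\Big[\sum_{t=1}^T\mathsf{KL}(f(\mathbf{x}_t),\hat p_t)\Big].$$ *)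

(* Defs.v *)
From HB Require Import structures.
From mathcomp Require Import all_boot all_order all_algebra.
From mathcomp Require Import all_classical all_reals all_analysis.

Set Implicit Arguments.
Unset Strict Implicit.
Unset Printing Implicit Defensive.
Import Order.TTheory GRing.Theory Num.Theory.
Import numFieldNormedType.Exports.

Local Open Scope classical_set_scope.
Local Open Scope ring_scope.

(** Probability distributions on the label set [M], labels being numbered from
    0 to M - 1. *)
Record label_dist (R : realType) (M : nat) := LabelDist {
  label_prob :> 'I_M -> R ;
  label_prob_ge0 : forall y, 0 <= label_prob y ;
  label_prob_sum1 : \sum_(y < M) label_prob y = 1 }.

(** Conventions: 0 log (0 / q) = 0 for every q, and p log (p / 0) = +oo for
    p > 0; the logarithm is natural. *)
Definition KL (R : realType) (M : nat) (p1 p2 : label_dist R M) : \bar R :=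
  (\sum_(y < M) (if p1 y == 0%R then 0
                 else if p2 y == 0%R then +oo
                 else (p1 y * ln (p1 y / p2 y))%:E))%E.

(** Law of an observation drawn from [Q Y] where the index [Y] is itself drawn
    from [p]. *)
Section mixture.
Context d (V : measurableType d) (R : realType) (M : nat).
Variables (p : label_dist R M) (Q : 'I_M -> probability V R).
Local Open Scope ereal_scope.

Definition mixture (A : set V) : \bar R := \sum_(y < M) (p y)%:E * Q y A.

Let mixture0 : mixture set0 = 0.
Proof. by rewrite /mixture big1// => y _; rewrite measure0 mule0. Qed.

Let mixture_ge0 A : 0 <= mixture A.
Proof.
by apply: sume_ge0 => y _; rewrite mule_ge0// lee_fin label_prob_ge0.
Qed.

Let mixture_sigma_additive : semi_sigma_additive mixture.
Proof.
pose m (k : nat) : {measure set V -> \bar R} :=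
  if @idP (k < M)%N is ReflectT h then
    mscale (NngNum (label_prob_ge0 p (Ordinal h))) (Q (Ordinal h))
  else mzero.
suff -> : mixture = msum m M by exact: measure_semi_sigma_additive.
apply/funext => A; apply: eq_bigr => y _; rewrite /m.
case: {-}_ / idP => [h|]; last by rewrite ltn_ord.
by rewrite /mscale/= (_ : Ordinal h = y)//; exact: val_inj.
Qed.

HB.instance Definition _ := isMeasure.Build _ _ _ mixture
  mixture0 mixture_ge0 mixture_sigma_additive.

Let mixture_setT : mixture [set: V] = 1.
Proof.
rewrite /mixture (eq_bigr (fun y => (p y)%:E)) => [|y _].
  by rewrite sumEFin label_prob_sum1.
by rewrite probability_setT mule1.
Qed.

HB.instance Definition _ := Measure_isProbability.Build _ _ _ mixture
  mixture_setT.

End mixture.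

(** Product of finitely many probability measures, on the library's measurable
    space of tuples: the law of independent coordinates. *)
Section product_law.
Context d (V : measurableType d) (R : realType).

Definition cons_pair n (z : V * n.-tuple V) : n.+1.-tuple V :=
  [the n.+1.-tuple V of z.1 :: z.2].

Let measurable_cons_pair n : measurable_fun [set: V * n.-tuple V] (@cons_pair n).
Proof. by apply: measurable_cons; [exact: measurable_fst|exact: measurable_snd]. Qed.

HB.instance Definition _ n :=
  isMeasurableFun.Build _ _ _ _ (@cons_pair n) (@measurable_cons_pair n).

Fixpoint product_law n : ('I_n -> probability V R) -> probability (n.-tuple V) R :=
  match n return ('I_n -> probability V R) -> probability (n.-tuple V) R with
  | 0 => fun=> dirac [tuple]
  | m.+1 => fun P =>
      distribution (P ord0 \x product_law (fun i => P (lift ord0 i)))%E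
                   (@cons_pair m)
  end.

Lemma product_lawE n (P : 'I_n -> probability V R) (A : 'I_n -> set V) :
  (forall i, measurable (A i)) ->
  product_law P [set w | forall i, A i (tnth w i)] = (\prod_(i < n) P i (A i))%E.
Proof.
elim: n P A => [|n IH] P A mA /=.
  rewrite big_ord0 diracE mem_set//=; by case.
rewrite big_ord_recl -IH// /distribution /pushforward -product_measure1E//.
  congr (product_measure1 _ _ _); apply/seteqP; split => -[v w]/=.
    by move=> h; split=> [|i]; [have := h ord0|have := h (lift ord0 i); rewrite tnthS].
  move=> [h0 h] i; case: (unliftP ord0 i) => [j|] ->//.
  by rewrite tnthS; exact: h.
rewrite (_ : [set _ | _] = \bigcap_(i in [set: 'I_n])
    ((fun w : n.-tuple V => tnth w i) @^-1` A (lift ord0 i))); last first.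
  by apply/seteqP; split => w /= h i => [_|]; [exact: h|exact: (h i Logic.I)].
apply: fin_bigcap_measurable => // i _.
rewrite -[X in measurable X]setTI; exact: measurable_tnth.
Qed.

End product_law.

(** R^K with its Borel (product) sigma-algebra. *)
Notation private_space R K := (K.-tuple (measurableTypeR R)).

Notation feature R d := 'rV[R]_d.

Definition prefix_tuple (V : Type) (n T : nat) (le_nT : (n <= T)%N)
    (w : T.-tuple V) : n.-tuple V :=
  [tuple tnth w (widen_ord le_nT i) | i < n].

(** [Rz t x y] is the law of R_t(y) when the feature revealed at time t is x;
    R^T may depend on the function class, which is fixed throughout. *)
Definition privatization (R : realType) (d K M T : nat) : Type :=
  'I_T -> feature R d -> 'I_M -> probability (private_space R K) R.

Definition locally_private (R : realType) (d K M T : nat) (eps delta : R)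
    (Rz : privatization R d K M T) : Prop :=
  forall (t : 'I_T) (x : feature R d) (y y' : 'I_M)
    (S : set (private_space R K)), measurable S ->
  (Rz t x y S <= (expR eps)%:E * Rz t x y' S + delta%:E)%E.

(** The index [t : 'I_T] stands for time t + 1, at which the learner has seen
    t + 1 features and t privatized labels. *)
Record prediction (R : realType) (d K M T : nat) := Prediction {
  predict :> forall t : 'I_T,
    t.+1.-tuple (feature R d) -> t.-tuple (private_space R K) ->
    label_dist R M ;
  measurable_predict : forall (t : 'I_T) (xs : t.+1.-tuple (feature R d))
    (y : 'I_M), measurable_fun setT (fun ys => predict xs ys y) }.

Section risk.
Context (R : realType) (d K M T : nat).
Local Open Scope ereal_scope.

Definition private_law (f : feature R d -> label_dist R M)
    (Rz : privatization R d K M T) (xs : T.-tuple (feature R d)) :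
    probability (T.-tuple (private_space R K)) R :=
  product_law (fun t : 'I_T => mixture (f (tnth xs t)) (Rz t (tnth xs t))).

Definition KL_risk (f : feature R d -> label_dist R M)
    (Rz : privatization R d K M T) (Phi : prediction R d K M T)
    (xs : T.-tuple (feature R d)) : \bar R :=
  \int[private_law f Rz xs]_w
    \sum_(t < T) KL (f (tnth xs t))
                    (Phi t (prefix_tuple (ltn_ord t) xs)
                           (prefix_tuple (ltnW (ltn_ord t)) w)).

Definition worst_case_KL_risk (F : 'I_K -> feature R d -> label_dist R M)
    (Rz : privatization R d K M T) (Phi : prediction R d K M T) : \bar R :=
  ereal_sup [set KL_risk (F j) Rz Phi xs | j in [set: 'I_K]
                                         & xs in [set: T.-tuple (feature R d)]].

Definition minimax_KL_risk (eps delta : R)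
    (F : 'I_K -> feature R d -> label_dist R M) : \bar R :=
  ereal_inf [set worst_case_KL_risk F Rz Phi
            | Rz in [set Rz | locally_private eps delta Rz]
            & Phi in [set: prediction R d K M T]].

End risk.
Arguments minimax_KL_risk {R d K M} T eps delta F.

Definition privacy_factor (R : realType) (eps : R) : R :=
  Num.min ((expR eps - 1) ^+ 2) 1 * expR eps.

(* Main.v *)
Require Import Defs.
From mathcomp Require Import all_boot all_order all_algebra.
From mathcomp Require Import all_classical all_reals all_analysis.
From mathcomp Require Import measurable_realfun.
From mathcomp Require Import ring lra.
Set Implicit Arguments.
Unset Strict Implicit.
Unset Printing Implicit Defensive.
Import Order.TTheory GRing.Theory Num.Theory.
Import numFieldNormedType.Exports.
Local Open Scope ring_scope.
Local Open Scope classical_set_scope.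

(* Let [N = 2 ^ m] be the largest power of two with [N <= K]. The label is [z]
   with probability [1 - a]; with probability [a] it is uniform on all [N]
   labels (base law) or on the half of them where the [j]-th nontrivial Walsh
   function is 1 ([j]-th law). The feature encodes [a], so nature may tune [a]
   to the horizon.

   Base and [j]-th law differ by a mass [a / 2] on labels impossible under the
   latter, so whatever mass a guess puts there, its two KL losses add up to at
   least [a ln 2 / 2]: the loss is linear in [a]. On the other hand the
   chi-square divergence between the two laws of a private view is quadratic in
   [a], and by the orthogonality of the Walsh functions (Parseval) these
   divergences sum over [j] to at most [a ^ 2 (e^eps + e^-eps - 2)], which is at
   most [a ^ 2 L] for [L = min((e^eps - 1)^2, 1) e^eps]. Hence for some [j] the
   divergences sum over time to [O(T a ^ 2 L / K)]; with [a] of order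
   [sqrt (K / (T L))] Le Cam's two-point method yields a risk of order [T a]. *)

(** * Bounded densities *)

Section density.
Context d (V : measurableType d) (R : realType).
Local Open Scope ereal_scope.

Lemma ge0_integral_setIC (mu : {measure set V -> \bar R}) (f : V -> \bar R)
    (A S : set V) :
  measurable A -> measurable S -> measurable_fun [set: V] f ->
  (forall v, 0 <= f v) ->
  \int[mu]_(v in A) f v =
    \int[mu]_(v in A `&` S) f v + \int[mu]_(v in A `&` ~` S) f v.
Proof.
move=> mA mS mf f0; rewrite -ge0_integral_setU//.
- by rewrite -setIUr setUv setIT.
- exact: measurableI.
- by apply: measurableI => //; exact: measurableC.
- exact: measurable_funTS.
- by apply/disj_set2P; rewrite setIACA setICr setI0.
Qed.

(** Truncation at [b] could lose mass only where [f >= b]; there the truncated density is the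
    constant [b], whose integral dominates [nu] by assumption. *)
Lemma le_measure_min_density (mu nu : probability V R) (f : V -> \bar R)
    (b : R) :
  (0 <= b)%R -> measurable_fun [set: V] f -> (forall v, 0 <= f v) ->
  (forall A, measurable A -> nu A = \int[mu]_(v in A) f v) ->
  (forall A, measurable A -> nu A <= b%:E * mu A) ->
  forall A, measurable A -> nu A = \int[mu]_(v in A) mine (f v) b%:E.
Proof.
move=> b0 mf f0 nuE nub A mA.
have mmin : measurable_fun [set: V] (fun v => mine (f v) b%:E).
  by apply: measurable_mine.
have min0 v : 0 <= mine (f v) b%:E by rewrite le_min f0 lee_fin.
apply/eqP; rewrite eq_le; apply/andP; split; last first.
  rewrite nuE//; apply: ge0_le_integral => //; try exact: measurable_funTS.
  by move=> v _; rewrite ge_min lexx.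
pose S := [set v | b%:E <= f v].
have mS : measurable S.
  by rewrite -[S]setTI; exact: emeasurable_fun_c_infty.
have mSC := measurableC mS.
rewrite nuE// !(ge0_integral_setIC _ mA mS)//; apply: leeD; last first.
  rewrite le_eqVlt; apply/orP; left; apply/eqP; apply: eq_integral => v.
  rewrite inE => -[_ /negP]; rewrite -ltNge => fb.
  by rewrite min_l// ltW.
rewrite -nuE; last exact: measurableI.
rewrite (eq_integral (cst b%:E)); last first.
  by move=> v; rewrite inE => -[_ bf]; rewrite min_r.
rewrite integral_cst; last exact: measurableI.
by apply: nub; exact: measurableI.
Qed.

(** Dually, raising the density to [a] could add mass only where [f < a]; there [nu] already
    dominates [a mu]. *)
Lemma ge_measure_max_density (mu nu : probability V R) (f : V -> \bar R)
    (a : R) :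
  (0 <= a)%R -> measurable_fun [set: V] f -> (forall v, 0 <= f v) ->
  (forall A, measurable A -> nu A = \int[mu]_(v in A) f v) ->
  (forall A, measurable A -> a%:E * mu A <= nu A) ->
  forall A, measurable A -> nu A = \int[mu]_(v in A) maxe (f v) a%:E.
Proof.
move=> a0 mf f0 nuE nua A mA.
have mmax : measurable_fun [set: V] (fun v => maxe (f v) a%:E).
  by apply: measurable_maxe.
have max0 v : 0 <= maxe (f v) a%:E by rewrite le_max f0.
apply/eqP; rewrite eq_le; apply/andP; split.
  rewrite nuE//; apply: ge0_le_integral => //; try exact: measurable_funTS.
  by move=> v _; rewrite le_max lexx.
pose S := [set v | a%:E <= f v].
have mS : measurable S.
  by rewrite -[S]setTI; exact: emeasurable_fun_c_infty.
have mSC := measurableC mS.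
rewrite nuE// !(ge0_integral_setIC _ mA mS)//; apply: leeD.
  rewrite le_eqVlt; apply/orP; left; apply/eqP; apply: eq_integral => v.
  by rewrite inE => -[_ fa]; rewrite max_l.
rewrite -nuE; last exact: measurableI.
rewrite (eq_integral (cst a%:E)); last first.
  move=> v; rewrite inE => -[_ /negP]; rewrite -ltNge => fa.
  by rewrite max_r// ltW.
rewrite integral_cst; last exact: measurableI.
by apply: nua; exact: measurableI.
Qed.

(** The Radon-Nikodym derivative obeys the bounds only almost everywhere; clamping it between [a]
    and [b] gives a version that obeys them pointwise and still represents [nu]. *)
Lemma bounded_density (mu nu : probability V R) (a b : R) :
  (0 <= a)%R -> (0 <= b)%R ->
  (forall A, measurable A -> a%:E * mu A <= nu A <= b%:E * mu A) ->
  exists q : V -> R, [/\ measurable_fun [set: V] q,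
    forall v, (a <= q v <= b)%R &
    forall phi : V -> \bar R, measurable_fun [set: V] phi ->
      (forall v, 0 <= phi v) ->
      \int[nu]_v phi v = \int[mu]_v (phi v * (q v)%:E)].
Proof.
move=> a0 b0 ab.
have numu : nu `<< mu.
  apply/null_content_dominatesP => A mA muA; apply/eqP.
  by have /andP[_] := ab A mA; rewrite muA mule0 measure_le0.
pose f := Radon_Nikodym_SigmaFinite.f nu mu.
have f0 v : 0 <= f v by exact: Radon_Nikodym_SigmaFinite.f_ge0.
have fi : mu.-integrable [set: V] f.
  exact: Radon_Nikodym_SigmaFinite.f_integrable.
have mf : measurable_fun [set: V] f by exact: measurable_int fi.
have fE A : measurable A -> nu A = \int[mu]_(v in A) f v.
  exact: Radon_Nikodym_SigmaFinite.f_integral.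
have minE := @le_measure_min_density mu nu f b b0 mf f0 fE.
have {}minE := minE (fun A mA => let: conj _ h := andP (ab A mA) in h).
have mmin : measurable_fun [set: V] (fun v => mine (f v) b%:E).
  by apply: measurable_mine.
have min0 v : 0 <= mine (f v) b%:E by rewrite le_min f0 lee_fin.
have maxE := @ge_measure_max_density mu nu _ a a0 mmin min0 minE.
have {}maxE := maxE (fun A mA => let: conj h _ := andP (ab A mA) in h).
set g := (fun v => maxe (mine (f v) b%:E) a%:E) in maxE.
have mg : measurable_fun [set: V] g by exact: measurable_maxe.
have le_ab : (a <= b)%R.
  have /andP[h1 h2] := ab _ measurableT.
  by have := le_trans h1 h2; rewrite !probability_setT !mule1 lee_fin.
have gab v : a%:E <= g v <= b%:E.
  by rewrite /g le_max lexx orbT/= ge_max ge_min lexx orbT/= lee_fin.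
have gfin v : g v \is a fin_num.
  have /andP[h1 h2] := gab v.
  by rewrite fin_numE gt_eqF ?(lt_le_trans _ h1) ?ltNyr// lt_eqF// (le_lt_trans h2)// ltry.
have g0 v : 0 <= g v by have /andP[+ _] := gab v; apply: le_trans; rewrite lee_fin.
exists (fine \o g); split => [|v|phi mphi phi0].
- exact: measurableT_comp.
- by have := gab v; rewrite -!lee_fin/= fineK.
under [RHS]eq_integral do rewrite /= fineK//.
rewrite -(Radon_Nikodym_SigmaFinite.change_of_variables numu)//.
apply: ge0_ae_eq_integral => //.
- exact: emeasurable_funM.
- exact: emeasurable_funM.
- by move=> v _; exact: mule_ge0.
- by move=> v _; exact: mule_ge0.
have : ae_eq mu [set: V] f g.
  by apply: integral_ae_eq => // E _ mE; rewrite -fE// maxE.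
by apply: filterS => v /= fg _; rewrite -[RHS]/(_ * g v) -fg.
Qed.

(* Integrates [2 phi r <= s phi ^+ 2 + r ^+ 2 / s] and takes
   [s = C / int phi r]. *)
Lemma integral_mul_sqr_le (mu : {measure set V -> \bar R}) (phi : V -> \bar R)
    (r : V -> R) (C : R) :
  measurable_fun [set: V] phi -> (forall v, 0 <= phi v) ->
  measurable_fun [set: V] r -> (forall v, 0 < r v)%R -> (0 < C)%R ->
  \int[mu]_v ((r v) ^+ 2)%:E <= C%:E ->
  (\int[mu]_v (phi v * (r v)%:E)) ^+ 2 <= C%:E * \int[mu]_v (phi v ^+ 2).
Proof.
move=> mphi phi0 mr r0 C0 rC.
set Y := \int[mu]_v (phi v * _); set X := \int[mu]_v (phi v ^+ 2).
have mphi2 : measurable_fun [set: V] (fun v => phi v ^+ 2).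
  by under eq_fun do rewrite expe2; exact: emeasurable_funM.
have phi20 v : 0 <= phi v ^+ 2 by exact: expe_ge0.
have mr2 : measurable_fun [set: V] (fun v => (r v ^+ 2)%:E).
  by apply/measurable_EFinP; exact: measurable_funX.
have X0 : 0 <= X by exact: integral_ge0.
have Y0 : 0 <= Y by apply: integral_ge0 => v _; rewrite mule_ge0// lee_fin ltW.
have key (s : R) : (0 < s)%R -> 2%:E * Y <= s%:E * X + (s^-1 * C)%:E.
  move=> s0.
  have si0 : (0 <= s^-1)%R by rewrite invr_ge0 ltW.
  rewrite EFinM.
  apply: (@le_trans _ _ (s%:E * X + s^-1%:E * \int[mu]_v ((r v) ^+ 2)%:E)).
    rewrite -!ge0_integralZl_EFin//; last 4 first.
    - by move=> v _; rewrite lee_fin sqr_ge0.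
    - exact: ltW.
    - by move=> v _; rewrite mule_ge0// lee_fin ltW.
    - by apply: emeasurable_funM => //; exact/measurable_EFinP.
    rewrite -ge0_integralD//; last 4 first.
    - by move=> v _; rewrite mule_ge0// lee_fin ltW.
    - exact: measurable_funeM.
    - by move=> v _; rewrite mule_ge0// lee_fin sqr_ge0.
    - exact: measurable_funeM.
    apply: ge0_le_integral => //.
    - by move=> v _; rewrite !mule_ge0// lee_fin ltW.
    - apply: measurable_funeM; apply: emeasurable_funM => //.
      exact/measurable_EFinP.
    - by apply: emeasurable_funD; apply: measurable_funeM.
    move=> v _; have := phi0 v; case: (phi v) => [x| |]//.
    - rewrite lee_fin => x0; rewrite -?EFin_expe -!EFinM -EFinD lee_fin.
      rewrite -subr_ge0.
      have -> : (s * x ^+ 2 + s^-1 * r v ^+ 2 - 2 * (x * r v) =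
        s * (x - s^-1 * r v) ^+ 2)%R by field; rewrite gt_eqF.
      by rewrite mulr_ge0 ?sqr_ge0// ltW.
    - by move=> _; rewrite expe2 mulyy gt0_muley ?lte_fin// addye// leey.
  by rewrite leeD2l// lee_wpmul2l// lee_fin.
have [Xy|] := eqVneq X +oo.
  by rewrite Xy gt0_muley ?lte_fin// leey.
move=> Xy; have Xfin : X \is a fin_num by rewrite ge0_fin_numE// ltey.
(* The choice [s = 1] in [key] makes [Y] finite, so that [s = C / fine Y] makes sense below. *)
have Yfin : Y \is a fin_num.
  rewrite ge0_fin_numE// ltey; apply/eqP => Yy; have := key 1%R ltr01.
  by rewrite Yy -(fineK Xfin) -EFinM -EFinD gt0_muley ?lte_fin// leye_eq.
rewrite -(fineK Xfin) -(fineK Yfin) -?EFin_expe -EFinM lee_fin.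
have : (0 <= fine Y)%R by rewrite fine_ge0.
rewrite le_eqVlt => /predU1P[<-|y0].
  by rewrite expr0n/= mulr_ge0 ?(ltW C0)// fine_ge0.
have := key (C / fine Y)%R (divr_gt0 C0 y0).
rewrite -(fineK Xfin) -{1}(fineK Yfin) -!EFinM -EFinD lee_fin.
set x := fine X; set y := fine Y.
have -> : ((C / y)^-1 * C = y)%R by field; rewrite !gt_eqF.
move=> h; have {}h : (y <= C / y * x)%R by lra.
by move: h; rewrite mulrAC ler_pdivlMr// -expr2.
Qed.
End density.

(** * Second-moment domination and its tensorization *)

Section mixture_integral.
Context d (V : measurableType d) (R : realType) (M : nat).
Local Open Scope ereal_scope.

Lemma ge0_integral_mixture (p : label_dist R M) (Q : 'I_M -> probability V R)
    (phi : V -> \bar R) :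
  measurable_fun [set: V] phi -> (forall v, 0 <= phi v) ->
  \int[mixture p Q]_v phi v = \sum_(y < M) (p y)%:E * \int[Q y]_v phi v.
Proof.
move=> mphi phi0.
(* The mixture is recast as a finite sum of scaled measures; the family is indexed by naturals,
   hence the zero measure from [M] on. *)
pose m (k : nat) : {measure set V -> \bar R} :=
  if @idP (k < M)%N is ReflectT h then
    mscale (NngNum (label_prob_ge0 p (Ordinal h))) (Q (Ordinal h))
  else mzero.
have mE (y : 'I_M) :
    m y = mscale (NngNum (label_prob_ge0 p y)) (Q y) :> {measure set V -> \bar R}.
  rewrite /m; case: {-}_ / idP => [h|]; last by rewrite ltn_ord.
  by rewrite (_ : Ordinal h = y)//; exact: val_inj.
rewrite (@eq_measure_integral _ _ _ _ (msum m M)) => [|A mA _]; last first.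
  by apply: eq_bigr => y _; rewrite mE.
rewrite ge0_integral_measure_sum//; apply: eq_bigr => y _.
by rewrite mE ge0_integral_mscale.
Qed.

End mixture_integral.

Section sqr_dominated.
Context (R : realType).
Local Open Scope ereal_scope.

(* Says that [P] has a density with respect to [mu] whose second moment under
   [mu] is at most [C], i.e. that the chi-square divergence of [P] from [mu] is
   at most [C - 1]. *)
Definition sqr_dominated d (V : measurableType d) (C : R)
    (P mu : probability V R) :=
  forall phi : V -> \bar R, measurable_fun [set: V] phi ->
    (forall v, 0 <= phi v) ->
    (\int[P]_v phi v) ^+ 2 <= C%:E * \int[mu]_v (phi v ^+ 2).

Lemma measurable_fun_sqre d (V : measurableType d) (phi : V -> \bar R) :
  measurable_fun [set: V] phi -> measurable_fun [set: V] (fun v => phi v ^+ 2).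
Proof. by move=> mphi; under eq_fun do rewrite expe2; exact: emeasurable_funM. Qed.

(** At the indicator of [A], domination reads [P A ^ 2 <= C mu A], and [(mu A + C / 4) ^ 2 - C mu A]
    is the square of [mu A - C / 4]. *)
Lemma sqr_dominated_le d (V : measurableType d) (C : R)
    (P mu : probability V R) (A : set V) :
  sqr_dominated C P mu -> (0 <= C)%R -> measurable A ->
  P A <= mu A + (C / 4)%:E.
Proof.
move=> PC C0 mA.
have mI : measurable_fun [set: V] (fun v => (\1_A v : R)%:E).
  by apply/measurable_EFinP; exact: measurable_indic.
have : P A ^+ 2 <= C%:E * mu A.
  have := PC _ mI (fun v => ltac:(by rewrite lee_fin)).
  have -> : (fun v : V => (\1_A v : R)%:E ^+ 2) = (fun v => (\1_A v)%:E).
    by apply/funext => v; rewrite indicE expe2 -EFinM -natrM mulnb andbb.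
  by rewrite !integral_indic// !setIT.
have Pfin : P A \is a fin_num by exact: fin_num_measure.
have mufin : mu A \is a fin_num by exact: fin_num_measure.
have P0 : 0 <= P A by exact: measure_ge0.
have mu0 : 0 <= mu A by exact: measure_ge0.
move: (P A) (mu A) Pfin mufin P0 mu0 => [x| |] [y| |]// _ _.
rewrite -EFin_expe -EFinM -EFinD !lee_fin => x0 y0 xy.
have yC : (0 <= y + C / 4)%R by lra.
rewrite -(@ler_pXn2r _ 2)//.
by apply: le_trans xy _; have := sqr_ge0 (y - C / 4)%R; lra.
Qed.

End sqr_dominated.

(** Tests domination on the constant 1; this is the nonnegativity of the chi-square divergence. *)
Lemma sqr_dominated_ge1 (R : realType) d (V : measurableType d) (C : R)
    (P mu : probability V R) : sqr_dominated C P mu -> 1 <= C.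
Proof.
move=> /(_ (cst 1%E)) h.
have {}h := h (measurable_cst _) (fun=> lee01).
have int1 (Q : probability V R) : (\int[Q]_v cst 1 v = 1)%E.
  by rewrite integral_cst// mul1e; exact: probability_setT.
have int1_sqr : (\int[mu]_v (cst 1 v ^+ 2) = 1)%E.
  by rewrite -[RHS](int1 mu); apply: eq_integral => v _; rewrite expe2 mule1.
by move: h; rewrite int1_sqr int1 expe2 !mule1 lee_fin.
Qed.

Section product_law_integral.
Context d (V : measurableType d) (R : realType).
Local Open Scope ereal_scope.

Lemma measurable_cons_pair n :
  measurable_fun [set: V * n.-tuple V] (@cons_pair _ V n).
Proof. by apply: measurable_cons; [exact: measurable_fst|exact: measurable_snd]. Qed.

Lemma ge0_integral_product_lawS n (P : 'I_n.+1 -> probability V R)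
    (phi : n.+1.-tuple V -> \bar R) :
  measurable_fun [set: n.+1.-tuple V] phi -> (forall w, 0 <= phi w) ->
  \int[product_law P]_w phi w =
  \int[P ord0]_v \int[product_law (fun i => P (lift ord0 i))]_w
    phi (cons_pair (v, w)).
Proof.
move=> mphi phi0; rewrite /= ge0_integral_pushforward//.
rewrite fubini_tonelli1// => [|z]; last exact: phi0.
exact: measurableT_comp mphi (@measurable_cons_pair n).
Qed.

(** Induction on the number of coordinates: domination in the first coordinate is applied to the
    inner integral, then the induction hypothesis to each section. *)
Lemma sqr_dominated_product_law n (C : 'I_n -> R)
    (P mu : 'I_n -> probability V R) :
  (forall i, (0 <= C i)%R) -> (forall i, sqr_dominated (C i) (P i) (mu i)) ->
  sqr_dominated (\prod_(i < n) C i)%R (product_law P) (product_law mu).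
Proof.
elim: n C P mu => [|n IH] C P mu C0 PC phi mphi phi0.
  by rewrite big_ord0 mul1e /= !integral_dirac//= ?diracT ?mul1e//;
    exact: measurable_fun_sqre.
have mphi2 := measurable_fun_sqre mphi.
have phi20 w : 0 <= phi w ^+ 2 by exact: expe_ge0.
rewrite !ge0_integral_product_lawS// big_ord_recl.
set C' := (\prod_(i < n) _)%R.
pose muS := product_law (fun i => mu (lift ord0 i)).
have mphic : measurable_fun [set: V * n.-tuple V] (phi \o @cons_pair _ V n).
  exact: measurableT_comp mphi (@measurable_cons_pair n).
have mphi2c := measurable_fun_sqre mphic.
have C'0 : (0 <= C')%R by apply: prodr_ge0 => i _; exact: C0.
apply: le_trans (PC ord0 _ _ _) _.
- apply: (measurable_fun_fubini_tonelli_F _ mphic) => z; exact: phi0.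
- by move=> v; exact: integral_ge0.
rewrite EFinM -muleA; apply: lee_wpmul2l; first by rewrite lee_fin.
have mG : measurable_fun [set: V] (fun v => \int[muS]_w (phi (cons_pair (v, w)) ^+ 2)).
  apply: (measurable_fun_fubini_tonelli_F _ mphi2c) => z; exact: phi20.
rewrite -ge0_integralZl_EFin//; last by move=> v _; apply: integral_ge0.
apply: ge0_le_integral => //.
- by move=> v _; apply/expe_ge0/integral_ge0 => w _; exact: phi0.
- apply: measurable_fun_sqre.
  apply: (measurable_fun_fubini_tonelli_F _ mphic) => z; exact: phi0.
- exact: measurable_funeM.
move=> v _; apply: IH => //.
exact: (measurableT_comp mphic (pair1_measurable v)).
Qed.

End product_law_integral.

(** * Private channels *)

Section channel.
Context d (V : measurableType d) (R : realType) (N : nat).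
Variables (Q : 'I_N -> probability V R) (eps : R).
Hypothesis Q_private : forall y y' A, measurable A ->
  (Q y A <= (expR eps)%:E * Q y' A)%E.
Local Open Scope ereal_scope.

(** Averages the privacy inequality, in both directions, over a second label drawn from [p]. *)
Lemma private_mixture_bounds (p : label_dist R N) y A : measurable A ->
  (expR (- eps))%:E * mixture p Q A <= Q y A <= (expR eps)%:E * mixture p Q A.
Proof.
move=> mA; rewrite /mixture.
have sum1 (x : \bar R) : x \is a fin_num -> x = \sum_(z < N) (p z)%:E * x.
  move=> xfin; rewrite -ge0_sume_distrl => [|z _]; last first.
    by rewrite lee_fin label_prob_ge0.
  by rewrite sumEFin label_prob_sum1 mul1e.
have p0 z : 0 <= (p z)%:E by rewrite lee_fin label_prob_ge0.
rewrite (sum1 (Q y A)); last exact: fin_num_measure.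
rewrite !ge0_sume_distrr => [|z _|z _]; try by rewrite mule_ge0.
apply/andP; split; apply: lee_sum => z _; rewrite muleCA lee_wpmul2l//.
- have a0 : 0 <= (expR (- eps))%:E by rewrite lee_fin expR_ge0.
  have := lee_wpmul2l a0 (Q_private z y mA).
  by rewrite muleA -EFinM -expRD addNr expR0 mul1e.
- exact: Q_private.
Qed.

Variable p : label_dist R N.
Let mu : probability V R := mixture p Q.

(** [G y y'] is the inner product in L2 of [mu] of the densities of [Q y] and [Q y']. Hence [C] is
    the second moment of the density of the mixture by [f], and the identity with [p] says that each
    density integrates to 1. *)
Lemma private_gram : exists G : 'I_N -> 'I_N -> R, [/\
  forall f : label_dist R N, let C := (\sum_y \sum_y' f y * f y' * G y y')%R in
    (0 < C)%R /\ sqr_dominated C (mixture f Q) mu,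
  forall y', (\sum_y p y * G y y' = 1)%R,
  forall y y', (G y y' = G y' y)%R,
  forall y, (G y y <= expR eps + expR (- eps) - 1)%R &
  (N%:R ^+ 2 <= \sum_y \sum_y' G y y')%R].
Proof.
pose a := expR (- eps); pose b := expR eps.
have a0 : (0 < a)%R by exact: expR_gt0.
have b0 : (0 < b)%R by exact: expR_gt0.
have ab1 : (a * b = 1)%R by rewrite /a /b -expRD addNr expR0.
have /choice[q qP] (y : 'I_N) := bounded_density (ltW a0) (ltW b0)
  (private_mixture_bounds p y).
have mq y : measurable_fun [set: V] (q y) by have [] := qP y.
have mqE y : measurable_fun [set: V] (fun v => (q y v)%:E).
  exact/measurable_EFinP.
have q0 y v : (0 <= q y v)%R.
  by have [_ /(_ v)/andP[h _] _] := qP y; exact: le_trans (ltW a0) h.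
have intQ y phi : measurable_fun [set: V] phi -> (forall v, 0 <= phi v) ->
    \int[Q y]_v phi v = \int[mu]_v (phi v * (q y v)%:E).
  by have [_ _] := qP y; exact.
have mqq y y' : measurable_fun [set: V] (fun v => (q y v * q y' v)%:E).
  by apply/measurable_EFinP; exact: measurable_funM.
have qq0 y y' v : 0 <= (q y v * q y' v)%:E by rewrite lee_fin mulr_ge0.
have int_q y : \int[mu]_v (q y v)%:E = 1.
  transitivity (\int[Q y]_v (cst 1 v)).
    by rewrite intQ//; apply: eq_integral => v _; rewrite mul1e.
  rewrite integral_cst// mul1e; exact: probability_setT.
have int_cst (c : R) : \int[mu]_v (cst c%:E v) = c%:E.
  rewrite integral_cst//; rewrite -[RHS]mule1; congr *%E.
  exact: probability_setT.
(* Expands [(q - a) (b - q) >= 0] with [a b = 1]. As [q] has mean 1, integration bounds its second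
   moment by [a + b - 1]. *)
have q_sqr y v : (q y v * q y v + 1 <= (a + b) * q y v)%R.
  have [_ /(_ v)/andP[h1 h2] _] := qP y.
  rewrite -ab1 -subr_ge0.
  have -> : ((a + b) * q y v - (q y v * q y v + a * b) =
    (q y v - a) * (b - q y v))%R by ring.
  by rewrite mulr_ge0// subr_ge0.
have le_qq y : \int[mu]_v (q y v * q y v)%:E <= (a + b - 1)%:E.
  have : \int[mu]_v ((q y v * q y v)%:E + cst 1 v) <= (a + b)%:E.
    have -> : (a + b)%:E = (a + b)%:E * \int[mu]_v (q y v)%:E.
      by rewrite int_q mule1.
    rewrite -ge0_integralZl_EFin//; last 2 first.
    - by move=> v _; rewrite lee_fin.
    - by rewrite addr_ge0// ltW.
    apply: ge0_le_integral => //.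
    - by move=> v _; rewrite adde_ge0.
    - exact: emeasurable_funD.
    - exact: measurable_funeM.
    - by move=> v _; rewrite -EFinD -EFinM lee_fin.
  rewrite ge0_integralD// int_cst.
  by rewrite -leeBrDr// EFinB.
pose G y y' := fine (\int[mu]_v (q y v * q y' v)%:E).
(* The bound [x y <= x ^ 2 + y ^ 2] makes every entry finite, so that [fine] loses nothing. *)
have GE y y' : \int[mu]_v (q y v * q y' v)%:E = (G y y')%:E.
  rewrite fineK// ge0_fin_numE; last by apply: integral_ge0.
  apply: (@le_lt_trans _ _ (\int[mu]_v (q y v * q y v + q y' v * q y' v)%:E)).
    apply: ge0_le_integral => //.
      by apply/measurable_EFinP; apply: measurable_funD; exact: measurable_funM.
    move=> v _; rewrite lee_fin -subr_ge0.
    have := sqr_ge0 (q y v - q y' v)%R.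
    have := mulr_ge0 (q0 y v) (q0 y' v).
    by nra.
  under eq_integral do rewrite EFinD.
  rewrite ge0_integralD//; apply: le_lt_trans (leeD (le_qq y) (le_qq y')) _.
  by rewrite -EFinD ltry.
have int_sqr (f : 'I_N -> R) : (forall y, 0 <= f y)%R ->
    \int[mu]_v ((\sum_y f y * q y v)%R ^+ 2)%:E =
    (\sum_y \sum_y' f y * f y' * G y y')%:E.
  move=> f0; rewrite (eq_integral (fun v => \sum_y \sum_y'
      (f y * f y')%:E * (q y v * q y' v)%:E)); last first.
    move=> v _; rewrite expr2 big_distrlr /= -sumEFin; apply: eq_bigr => y _.
    rewrite -sumEFin; apply: eq_bigr => y' _.
    by rewrite -EFinM; congr EFin; ring.
  have ff0 y y' : 0 <= (f y * f y')%:E by rewrite lee_fin mulr_ge0.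
  rewrite ge0_integral_sum//; last 2 first.
  - by move=> y; apply: emeasurable_sum => y'; exact: measurable_funeM.
  - by move=> y v _; apply: sume_ge0 => y' _; exact: mule_ge0.
  rewrite -sumEFin; apply: eq_bigr => y _.
  rewrite ge0_integral_sum//; last 2 first.
  - by move=> y'; exact: measurable_funeM.
  - by move=> y' v _; exact: mule_ge0.
  rewrite -sumEFin; apply: eq_bigr => y' _.
  by rewrite ge0_integralZl_EFin ?GE ?mulr_ge0.
have int_mix (f : label_dist R N) phi : measurable_fun [set: V] phi ->
    (forall v, 0 <= phi v) ->
    \int[mixture f Q]_v phi v =
    \sum_y (f y)%:E * \int[mu]_v (phi v * (q y v)%:E).
  by move=> mphi phi0; rewrite ge0_integral_mixture//; apply: eq_bigr => y _; rewrite intQ.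
exists G; split.
- move=> f C.
  pose r v := (\sum_y f y * q y v)%R.
  have f0 := label_prob_ge0 f.
  have mr : measurable_fun [set: V] r.
    by apply: measurable_sum => y; exact: measurable_funM.
  (* This lower bound, inherited from privacy, gives the strict positivity of [r] and [C] that
     [integral_mul_sqr_le] asks for. *)
  have ra v : (a <= r v)%R.
    rewrite -[leLHS]mul1r -(label_prob_sum1 f) mulr_suml.
    apply: ler_sum => y _; apply: ler_wpM2l => //.
    by have [_ /(_ v)/andP[]] := qP y.
  have rC : \int[mu]_v (r v ^+ 2)%:E = C%:E by exact: int_sqr.
  have C0 : (0 < C)%R.
    apply: (@lt_le_trans _ _ (a ^+ 2)%R); first exact: exprn_gt0.
    rewrite -lee_fin -rC.
    have -> : (a ^+ 2)%:E = \int[mu]_v (cst (a ^+ 2)%:E v).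
      by rewrite int_cst.
    apply: ge0_le_integral => //.
    - by move=> v _; rewrite lee_fin sqr_ge0.
    - by apply/measurable_EFinP; exact: measurable_funX.
    - by move=> v _; rewrite lee_fin ler_pXn2r ?nnegrE ?(ltW a0)// (le_trans (ltW a0)).
  split=> // phi mphi phi0.
  have -> : \int[mixture f Q]_v phi v = \int[mu]_v (phi v * (r v)%:E).
    rewrite int_mix//.
    rewrite (eq_integral (fun v => \sum_y (f y)%:E * (phi v * (q y v)%:E))); last first.
      move=> v _; rewrite -sumEFin ge0_sume_distrr => [|y _]; last first.
        by rewrite lee_fin mulr_ge0.
      by apply: eq_bigr => y _; rewrite EFinM muleCA.
    rewrite ge0_integral_sum//; last 2 first.
    - by move=> y; apply: measurable_funeM; exact: emeasurable_funM.
    - by move=> y v _; rewrite !mule_ge0// lee_fin.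
    apply: eq_bigr => y _; rewrite ge0_integralZl_EFin//.
    - by move=> v _; rewrite mule_ge0// lee_fin.
    - exact: emeasurable_funM.
  apply: integral_mul_sqr_le => //; last by rewrite rC.
  by move=> v; exact: lt_le_trans (ra v).
- move=> y'; apply: EFin_inj; rewrite -(int_q y') /mu int_mix//; last first.
    by move=> v; rewrite lee_fin.
  rewrite -sumEFin; apply: eq_bigr => y _; rewrite EFinM -GE; congr *%E.
  by apply: eq_integral => v _; rewrite -EFinM mulrC.
- by move=> y y'; rewrite /G; under eq_integral do rewrite mulrC.
- by move=> y; rewrite -lee_fin -GE -/b -/a [(b + a)%R]addrC; exact: le_qq.
- pose one (y : 'I_N) : R := 1%R.
  have <- : (\sum_y \sum_y' one y * one y' * G y y' = \sum_y \sum_y' G y y')%R.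
    by apply: eq_bigr => y _; apply: eq_bigr => y' _; rewrite !mul1r.
  rewrite -lee_fin -int_sqr; last by move=> y; exact: ler01.
  pose s v := (\sum_y one y * q y v)%R.
  have ms : measurable_fun [set: V] (fun v => (s v)%:E).
    by apply/measurable_EFinP; apply: measurable_sum => y; exact: measurable_funM.
  have s0 v : 0 <= (s v)%:E by rewrite lee_fin sumr_ge0// => y _; rewrite mul1r.
  have <- : (\int[mu]_v ((s v)%:E * (cst 1%R v)%:E)) ^+ 2 = (N%:R ^+ 2)%:E.
    rewrite EFin_expe; congr (_ ^+ 2).
    rewrite (eq_integral (fun v => \sum_y (q y v)%:E)); last first.
      move=> v _; rewrite mule1 -sumEFin; apply: eq_bigr => y _.
      by rewrite mul1r.
    rewrite ge0_integral_sum//; last by move=> y v _; rewrite lee_fin.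
    by rewrite (eq_bigr (fun=> 1%:E)) => [|y _]; rewrite ?int_q// sumEFin sumr_const card_ord.
  (* Cauchy-Schwarz against the constant 1: the sum of all densities has mean [N], so its second
     moment is at least [N ^ 2]. *)
  apply: le_trans (integral_mul_sqr_le ms s0 _ _ ltr01 _) _ => //.
    have -> : \int[mu]_v (cst 1%R v ^+ 2)%:E = \int[mu]_v (cst 1%:E v).
      by apply: eq_integral => v _; rewrite expr1n.
    by rewrite int_cst.
  by rewrite mul1e; under eq_integral do rewrite -EFin_expe.
Qed.

End channel.

(** * Total divergence of a code seen through a private channel *)

Section code_budget.
Context d (V : measurableType d) (R : realType) (N : nat).

(** Each excess [C j - 1] is [c ^ 2] times the quadratic form of [G] at [H j]. Parseval turns the
    sum over [j] into [N] times the trace of [G] minus the sum of its entries, and both are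
    controlled by [private_gram]. *)
Lemma private_code_budget (Q : 'I_N -> probability V R) (eps c : R)
    (H : 'I_N -> 'I_N -> R) (f : 'I_N -> label_dist R N) (p : label_dist R N) :
  (forall y y' A, measurable A -> (Q y A <= (expR eps)%:E * Q y' A)%E) ->
  (forall j, \sum_y H j y = 0) ->
  (forall y y', \sum_j H j y * H j y' = (N * (y == y'))%:R - 1) ->
  (forall j y, f j y = p y + c * H j y) ->
  exists C : 'I_N -> R,
    (forall j, 0 < C j /\ sqr_dominated (C j) (mixture (f j) Q) (mixture p Q)) /\
    \sum_j (C j - 1) <= (c * N%:R) ^+ 2 * (expR eps + expR (- eps) - 2).
Proof.
move=> Q_private H0 HH fE.
have [G [domG Gp Gsym Gdiag Gsum]] := private_gram Q_private p.
exists (fun j => \sum_y \sum_y' f j y * f j y' * G y y').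
split=> [j|]; first exact: domG.
have CE j : \sum_y \sum_y' f j y * f j y' * G y y' - 1 =
    c ^+ 2 * \sum_y \sum_y' H j y * H j y' * G y y'.
  (* The terms linear in [H j] vanish: [p] paired with [G] gives the constant 1, and [H j] sums to
     0. *)
  have pG (h : 'I_N -> R) : \sum_y \sum_y' h y * p y' * G y y' = \sum_y h y.
    apply: eq_bigr => y _; rewrite -[RHS]mulr1 -(Gp y) mulr_sumr.
    by apply: eq_bigr => y' _; rewrite Gsym mulrA.
  transitivity (\sum_y \sum_y' (p y * p y' * G y y') +
      c * (\sum_y \sum_y' H j y * p y' * G y y') +
      c * (\sum_y \sum_y' H j y' * p y * G y' y) +
      c ^+ 2 * (\sum_y \sum_y' H j y * H j y' * G y y') - 1).
    congr (_ - 1); rewrite !mulr_sumr -!big_split/=; apply: eq_bigr => y _.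
    rewrite !mulr_sumr -!big_split/=; apply: eq_bigr => y' _.
    by rewrite !fE (Gsym y' y); ring.
  rewrite [X in _ + c * X + _ - 1]exchange_big/= !pG H0 label_prob_sum1.
  ring.
rewrite (eq_bigr _ (fun j _ => CE j)) -mulr_sumr exprMn -[leRHS]mulrA.
apply: ler_wpM2l; first exact: sqr_ge0.
have -> : \sum_j \sum_y \sum_y' H j y * H j y' * G y y' =
    N%:R * \sum_y G y y - \sum_y \sum_y' G y y'.
  rewrite exchange_big/= mulr_sumr -sumrB; apply: eq_bigr => y _.
  rewrite exchange_big/= (bigD1 y)//= -mulr_suml HH eqxx muln1.
  rewrite [X in _ = _ - X](bigD1 y)//= opprD addrA mulrBl mul1r; congr (_ + _).
  rewrite -sumrN; apply: eq_bigr => y' y'y.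
  by rewrite -mulr_suml HH eq_sym (negbTE y'y) muln0 sub0r mulN1r.
have diag : \sum_y G y y <= N%:R * (expR eps + expR (- eps) - 1).
  rewrite (le_trans (ler_sum _ (fun y _ => Gdiag y)))//.
  by rewrite sumr_const card_ord mulr_natl.
have := ler_wpM2l (ler0n R N) diag.
move: Gsum; rewrite !expr2; set x : R := N%:R; lra.
Qed.

End code_budget.

(** * Walsh functions *)

Section walsh.
Context (R : realType) (m : nat).
Implicit Types u v w : 'rV['F_2]_m.

(** The nontrivial character of the additive group [F_2]. *)
Definition bit_sign (x : 'F_2) : R := if x == 0 then 1 else -1.

Lemma bit_signD x y : bit_sign (x + y) = bit_sign x * bit_sign y.
Proof.
rewrite /bit_sign -!val_eqE.
by case: x y => -[|[|//]] ? [[|[|//]] ?] /=; rewrite ?mulr1 ?mul1r// mulrNN mulr1.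
Qed.

(** The characters of [F_2 ^ m], i.e. the entries of the Sylvester-Hadamard matrix. *)
Definition walsh u v : R := bit_sign (\sum_i u 0 i * v 0 i).

Lemma walshDl u v w : walsh (u + v) w = walsh u w * walsh v w.
Proof.
rewrite /walsh -bit_signD -big_split/=; congr bit_sign.
by apply: eq_bigr => i _; rewrite mxE mulrDl.
Qed.

Lemma walshC u v : walsh u v = walsh v u.
Proof. by congr bit_sign; apply: eq_bigr => i _; rewrite mulrC. Qed.

Lemma walsh0r u : walsh u 0 = 1.
Proof. by rewrite /walsh big1 => [|i _]; rewrite /bit_sign ?eqxx// mxE mulr0. Qed.

Lemma walsh_sign u v : walsh u v = 1 \/ walsh u v = -1.
Proof. by rewrite /walsh /bit_sign; case: ifP => _; [left|right]. Qed.

Lemma sum_walsh u : \sum_v walsh u v = (2 ^ m * (u == 0))%:R.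
Proof.
have [->|u0] := eqVneq u 0.
  rewrite muln1 (eq_bigr (fun=> 1)) => [|v _]; last by rewrite walshC walsh0r.
  by rewrite sumr_const card_mx card_Fp// mul1n.
have [i ui] : exists i, u 0 i != 0.
  by apply/rV0Pn.
(* Flipping a coordinate of [v] at which [u] is nonzero changes the sign, so the sum equals its own
   opposite. *)
have chiN v : walsh u (v + delta_mx 0 i) = - walsh u v.
  rewrite walshC walshDl !(walshC _ u) [X in _ * X]/walsh (bigD1 i)//= mxE !eqxx.
  rewrite big1 => [|j ji]; last by rewrite mxE (negbTE ji) andbF mulr0.
  by rewrite mulr1 addr0 /bit_sign (negbTE ui) mulrN1.
have : \sum_v walsh u v = - \sum_v walsh u v.
  rewrite [LHS](reindex_inj (addIr (delta_mx 0 i))) -sumrN/=.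
  by apply: eq_bigr => v _; exact: chiN.
by rewrite muln0; lra.
Qed.

End walsh.

Lemma addrr_F2 m (u v : 'rV['F_2]_m) : (u + v == 0) = (u == v).
Proof.
have -> : u + v = u - v.
  apply/rowP => i; rewrite !mxE; congr (_ + _).
  by apply/eqP; rewrite -val_eqE; case: (v 0 i) => -[|[|//]].
by rewrite subr_eq0.
Qed.

(* The rows other than [z] are the nontrivial Walsh functions; putting zero in
   place of the trivial one makes row [z] stand for the unperturbed law. *)
Lemma walsh_code (R : realType) (m : nat) :
  exists (H : 'I_(2 ^ m) -> 'I_(2 ^ m) -> R) (z : 'I_(2 ^ m)), [/\
    forall y, H z y = 0,
    forall j y, j != z -> H j y = 1 \/ H j y = -1,
    forall j, j != z -> H j z = 1,
    forall j k, j != k -> \sum_y H j y * H k y = 0 &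
    (forall j, \sum_y H j y = 0) /\
    forall y y', \sum_j H j y * H j y' = (2 ^ m * (y == y'))%:R - 1].
Proof.
have cE : #|{: 'rV['F_2]_m}| = (2 ^ m)%N by rewrite card_mx card_Fp// mul1n.
pose e (i : 'I_(2 ^ m)) : 'rV['F_2]_m := enum_val (cast_ord (esym cE) i).
have ebij : bijective e.
  apply: bij_comp; first exact: enum_val_bij.
  exact: (Bijective (cast_ordK _) (cast_ordKV _)).
have einj := bij_inj ebij.
have [e' eK e'K] := ebij.
(* Row [z] belongs to the trivial character, and column [z] evaluates characters at 0, where they
   are all 1. *)
pose z := e' 0; have ez : e z = 0 by exact: e'K.
have ez0 j : (e j == 0) = (j == z) by rewrite -ez (inj_eq einj).
have sum_e u : \sum_y walsh R u (e y) = (2 ^ m * (u == 0))%:R.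
  by rewrite -sum_walsh [RHS](reindex e)//; exact: onW_bij.
exists (fun j y => if j == z then 0 else walsh R (e j) (e y)), z.
split.
- by move=> y; rewrite eqxx.
- by move=> j y /negbTE ->; exact: walsh_sign.
- by move=> j /negbTE ->; rewrite ez walsh0r.
- move=> j k jk /=; case: (eqVneq j z) => _; first by rewrite big1// => y _; rewrite mul0r.
  case: (eqVneq k z) => _; first by rewrite big1// => y _; rewrite mulr0.
  under eq_bigr do rewrite -walshDl.
  by rewrite sum_e addrr_F2 (inj_eq einj) (negbTE jk) muln0.
split=> [j|y y'] /=.
  case: (eqVneq j z) => jz; first by rewrite big1.
  by rewrite sum_e ez0 (negbTE jz) muln0.
have <- : \sum_j walsh R (e j) (e y) * walsh R (e j) (e y') =
    (2 ^ m * (y == y'))%:R.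
  rewrite (eq_bigr (fun j => walsh R (e y + e y') (e j))) => [|j _]; last first.
    by rewrite walshDl !(walshC R (e j)).
  by rewrite sum_e addrr_F2 (inj_eq einj).
(* The trivial character contributes 1 to the full Gram sum, and 0 once its row is replaced by zero;
   hence the [- 1]. *)
rewrite (bigD1 z)//= [in RHS](bigD1 z)//= eqxx mul0r add0r.
rewrite ez ![walsh R 0 _]walshC !walsh0r mul1r addrAC subrr add0r.
by apply: eq_bigr => j /negbTE ->.
Qed.

(** * Kullback-Leibler divergence *)

Section KL_bounds.
Context (R : realType) (M : nat).

(* Termwise, [x ln (x / p) >= x (ln c + 1) - c p] is the tangent line at
   [p = x / c]. *)
Lemma KL_ge_tangent (p1 p2 : label_dist R M) (c : 'I_M -> R) :
  (forall y, 0 <= c y) -> (forall y, p1 y != 0 -> 0 < c y) ->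
  ((\sum_y (p1 y * (ln (c y) + 1) - c y * p2 y))%:E <= KL p1 p2)%E.
Proof.
move=> c_ge0 c_gt0; rewrite /KL -sumEFin; apply: lee_sum => y _.
have [p10|p10] := eqVneq (p1 y) 0.
  rewrite p10 lee_fin mul0r sub0r oppr_le0 mulr_ge0 ?label_prob_ge0//.
case: eqVneq => [p20|p20]; first by rewrite leey.
have c0 := c_gt0 y p10.
have p1_gt0 : 0 < p1 y by rewrite lt_def p10 label_prob_ge0.
have p2_gt0 : 0 < p2 y by rewrite lt_def p20 label_prob_ge0.
rewrite lee_fin.
set x := p1 y in p1_gt0 *; set t := p2 y in p2_gt0 *.
have ct0 : 0 < c y * t / x by rewrite !mulr_gt0 ?invr_gt0.
have : ln (c y * t / x) <= c y * t / x - 1.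
  have {1}-> : c y * t / x = 1 + (c y * t / x - 1) by ring.
  by apply: le_ln1Dx; lra.
rewrite !lnM ?posrE ?mulr_gt0// ?invr_gt0// !lnV ?posrE// => h.
have {}h := ler_wpM2l (ltW p1_gt0) h.
have xE : x * (c y * t / x - 1) = c y * t - x by field; rewrite gt_eqF.
rewrite xE in h; lra.
Qed.

End KL_bounds.

(** * Divergence from hidden-label laws to an arbitrary guess *)

Section hidden_label.
Context (R : realType) (N : nat) (z : 'I_N).

Lemma hidden_label_dist (delta : R) (h : 'I_N -> R) :
  0 <= delta <= 1 -> (forall y, -1 <= h y) -> \sum_y h y = 0 ->
  exists p : label_dist R N,
    forall y, p y = (1 - delta) * (y == z)%:R + delta / N%:R * (1 + h y).
Proof.
move=> /andP[d0 d1] h1 h0.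
have N0 : (0 < N)%N by exact: leq_trans (ltn_ord z).
pose p y := (1 - delta) * (y == z)%:R + delta / N%:R * (1 + h y).
have p0 y : 0 <= p y.
  apply: addr_ge0; apply: mulr_ge0; rewrite ?ler0n ?subr_ge0//.
    by rewrite divr_ge0.
  by have := h1 y; lra.
have p1 : \sum_y p y = 1.
  rewrite big_split/= -!mulr_sumr big_split/= h0 sumr_const card_ord addr0.
  rewrite (bigD1 z)//= eqxx big1 => [|y /negbTE ->//].
  by rewrite addr0 mulr1 divfK ?pnatr_eq0 -?lt0n// subrK.
by exists (LabelDist p0 p1).
Qed.

Variables (delta : R) (h : 'I_N -> R).
Hypothesis h_sign : forall y, h y = 1 \/ h y = -1.
Hypothesis hz : h z = 1.
Hypothesis h0 : \sum_y h y = 0.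

(* [(1 - h) / 2] is the indicator of the labels that [h] forbids. *)
Let forbidden (q : label_dist R N) := \sum_y q y * ((1 - h y) / 2).

(** Tangent bound with [c] equal to 2 on the forbidden labels and 1 elsewhere. As [z] is allowed,
    [p] gives the forbidden labels mass [delta / 2]. *)
Lemma KL_base_ge (p q : label_dist R N) :
  (forall y, p y = (1 - delta) * (y == z)%:R + delta / N%:R) ->
  ((delta / 2 * ln 2 - forbidden q)%:E <= KL p q)%E.
Proof.
move=> pE.
have N0 : (0 < N)%N by exact: leq_trans (ltn_ord z).
apply: le_trans _ (@KL_ge_tangent _ _ p q (fun y => 1 + (1 - h y) / 2) _ _).
- rewrite lee_fin le_eqVlt; apply/orP; left; apply/eqP.
  have lnE y : ln (1 + (1 - h y) / 2) = ln 2 * ((1 - h y) / 2) :> R.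
    case: (h_sign y) => ->; first by rewrite subrr mul0r addr0 ln1 mulr0.
    by rewrite opprK divff ?mulr1.
  transitivity (\sum_y (ln 2 * (p y * ((1 - h y) / 2)) + p y - q y -
      q y * ((1 - h y) / 2))); last first.
    by apply: eq_bigr => y _; rewrite lnE; ring.
  rewrite !sumrB big_split/= !label_prob_sum1 -mulr_sumr addrK.
  congr (_ - _); rewrite mulrC; congr (_ * _).
  rewrite (eq_bigr (fun y => (1 - delta) * ((y == z)%:R * ((1 - h y) / 2)) +
      delta / N%:R * ((1 - h y) / 2))) => [|y _]; last by rewrite pE; ring.
  rewrite big_split/= -!mulr_sumr (bigD1 z)//= eqxx hz subrr mul0r mulr0 add0r.
  rewrite big1 => [|y /negbTE ->]; last by rewrite mul0r.
  rewrite mulr0 add0r -mulr_suml sumrB h0 subr0 sumr_const card_ord.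
  by rewrite mulrA divfK// pnatr_eq0 -lt0n.
- by move=> y; case: (h_sign y) => ->; lra.
- by move=> y _; case: (h_sign y) => ->; lra.
Qed.

(** Tangent bound with [c] the indicator of the allowed labels: [p] lives on these, so the bound is
    one minus the mass that [q] gives them. *)
Lemma KL_code_ge (p q : label_dist R N) :
  (forall y, p y = (1 - delta) * (y == z)%:R + delta / N%:R * (1 + h y)) ->
  ((forbidden q)%:E <= KL p q)%E.
Proof.
move=> pE; have N11 : 1 <> -1 :> R by lra.
apply: le_trans _ (@KL_ge_tangent _ _ p q (fun y => (1 + h y) / 2) _ _).
- rewrite lee_fin le_eqVlt; apply/orP; left; apply/eqP.
  transitivity (\sum_y (p y - q y + q y * ((1 - h y) / 2))).
    by rewrite big_split/= sumrB !label_prob_sum1 subrr add0r.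
  apply: eq_bigr => y _; case: (h_sign y) => hy; rewrite hy.
    have -> : (1 + 1) / 2 = 1 :> R by field.
    by rewrite ln1; ring.
  have -> : p y = 0.
    rewrite pE hy subrr mulr0 addr0; case: eqVneq => [yz|]; last by rewrite mulr0.
    by move: hy; rewrite yz hz => /N11.
  by field.
- by move=> y; case: (h_sign y) => ->; lra.
- move=> y; case: (h_sign y) => hy; rewrite hy; first by move=> _; lra.
  rewrite pE hy subrr mulr0 addr0; case: (eqVneq y z) => [yz|_].
    by move: hy; rewrite yz hz => /N11.
  by rewrite mulr0 eqxx.
Qed.

End hidden_label.

Lemma KL_ge0 (R : realType) (M : nat) (p q : label_dist R M) : (0 <= KL p q)%E.
Proof.
apply: le_trans _ (@KL_ge_tangent _ _ p q (cst 1) _ _) => //.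
rewrite lee_fin (eq_bigr (fun y => p y - q y)) => [|y _].
  by rewrite sumrB !label_prob_sum1 subrr.
by rewrite ln1 add0r mulr1 mul1r.
Qed.

(** Compares the suprema over simple functions that define the integrals, so that the KL loss can be
    bounded below with no measurability argument for it. *)
Lemma ge0_le_integral_sup d (V : measurableType d) (R : realType)
    (mu : {measure set V -> \bar R}) (f g : V -> \bar R) :
  (forall v, 0 <= f v)%E -> (forall v, f v <= g v)%E ->
  (\int[mu]_v f v <= \int[mu]_v g v)%E.
Proof.
move=> f0 fg.
rewrite !ge0_integralTE// => [|v]; last exact: le_trans (fg v).
apply: le_ereal_sup => _ /= [s sf <-].
by exists s => // v; exact: le_trans (sf v) (fg v).
Qed.

(** * Le Cam's method *)

Lemma measurable_prefix_tuple d (V : measurableType d) (n T : nat)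
    (le_nT : (n <= T)%N) :
  measurable_fun [set: T.-tuple V] (@prefix_tuple V n T le_nT).
Proof.
apply/measurable_fun_tnthP => i; rewrite [X in measurable_fun _ X](_ : _ =
    (fun w : T.-tuple V => tnth w (widen_ord le_nT i))).
  exact: measurable_tnth.
by apply/funext => w /=; rewrite tnth_mktuple.
Qed.

Section two_point.
Context (R : realType) (d K M T : nat).
Variables (Rz : privatization R d K M T) (Phi : prediction R d K M T).
Variable xs : T.-tuple (feature R d).
Implicit Types f : feature R d -> label_dist R M.
Local Open Scope ereal_scope.

Let guess (t : 'I_T) (w : T.-tuple (private_space R K)) : label_dist R M :=
  Phi t (prefix_tuple (ltn_ord t) xs) (prefix_tuple (ltnW (ltn_ord t)) w).

(** Markov's inequality at each time: the loss is at least [kappa] on [A t] and nonnegative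
    elsewhere. *)
Lemma KL_risk_ge f (A : 'I_T -> set (T.-tuple (private_space R K)))
    (kappa : R) :
  (0 <= kappa)%R -> (forall t, measurable (A t)) ->
  (forall t w, A t w -> kappa%:E <= KL (f (tnth xs t)) (guess t w)) ->
  \sum_(t < T) kappa%:E * private_law f Rz xs (A t) <= KL_risk f Rz Phi xs.
Proof.
move=> k0 mA AKL.
have mI t : measurable_fun [set: T.-tuple (private_space R K)]
    (fun w => kappa%:E * (\1_(A t) w)%:E).
  by apply: measurable_funeM; apply/measurable_EFinP; exact: measurable_indic.
have I0 t w : 0 <= kappa%:E * (\1_(A t) w)%:E.
  by rewrite mule_ge0// lee_fin.
apply: (@le_trans _ _ (\int[private_law f Rz xs]_w
    \sum_(t < T) kappa%:E * (\1_(A t) w)%:E)).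
  rewrite ge0_integral_sum//.
  rewrite le_eqVlt; apply/orP; left; apply/eqP; apply: eq_bigr => t _.
  rewrite ge0_integralZl_EFin//; first by rewrite integral_indic// setIT.
  by apply/measurable_EFinP; exact: measurable_indic.
apply: ge0_le_integral_sup => [w|w]; first exact: sume_ge0.
apply: lee_sum => t _; rewrite indicE.
case: (boolP (w \in A t)) => [/set_mem/AKL|_]; first by rewrite mule1.
by rewrite mule0 KL_ge0.
Qed.

(* Le Cam's two-point method: at each time the learner is charged [kappa]
   under [f0] or under [f1], according to the side of a threshold on which the
   linear statistic [s] of its guess falls. *)
Lemma two_point_risk f0 f1 (C : 'I_T -> R) (s : 'I_M -> R) (kappa : R) :
  (0 <= kappa)%R -> (forall t, 0 <= C t)%R ->
  (forall t, sqr_dominated (C t)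
    (mixture (f1 (tnth xs t)) (Rz t (tnth xs t)))
    (mixture (f0 (tnth xs t)) (Rz t (tnth xs t)))) ->
  (forall t (q : label_dist R M),
    (2 * kappa - \sum_y q y * s y)%R%:E <= KL (f0 (tnth xs t)) q) ->
  (forall t (q : label_dist R M),
    (\sum_y q y * s y)%R%:E <= KL (f1 (tnth xs t)) q) ->
  (kappa * T%:R * (1 - (\prod_t C t) / 4))%:E <=
    KL_risk f0 Rz Phi xs + KL_risk f1 Rz Phi xs.
Proof.
move=> k0 C0 Cdom KL0 KL1.
pose g t w := (\sum_y guess t w y * s y)%R.
have mg t : measurable_fun [set: T.-tuple (private_space R K)] (g t).
  apply: measurable_sum => y; apply: measurable_funM => //.
  apply: (measurableT_comp (measurable_predict Phi _ y)).
  exact: measurable_prefix_tuple.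
pose A t := [set w | (g t w <= kappa)%R].
have mA t : measurable (A t).
  rewrite -[A t]setTI; apply: (@measurable_fun_le _ _ _ _ _ (cst kappa)) => //.
have mAC t := measurableC (mA t).
have R0 := @KL_risk_ge f0 A kappa k0 mA.
have R1 := @KL_risk_ge f1 (fun t => ~` A t) kappa k0 mAC.
apply: le_trans (leeD (R0 _) (R1 _)).
- rewrite -big_split/=; set c := (1 - _)%R.
  have -> : (kappa * T%:R * c)%:E = \sum_(t < T) (kappa * c)%:E.
    by rewrite sumEFin sumr_const card_ord -mulr_natl; congr EFin; ring.
  apply: lee_sum => t _.
  (* At time [t] the guess is charged on [A t] under [f0] and on its complement under [f1];
     closeness of the two laws keeps these probabilities from both being small. *)
  have PA : private_law f1 Rz xs (A t) <=
      private_law f0 Rz xs (A t) + ((\prod_t C t) / 4)%R%:E.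
    apply: sqr_dominated_le => //; last by apply: prodr_ge0.
    exact: sqr_dominated_product_law.
  rewrite -ge0_muleDr// EFinM; apply: lee_wpmul2l; first by rewrite lee_fin.
  have -> : private_law f1 Rz xs (~` A t) = 1 - private_law f1 Rz xs (A t).
    exact: probability_setC.
  have fin0 : private_law f0 Rz xs (A t) \is a fin_num by exact: fin_num_measure.
  have fin1 : private_law f1 Rz xs (A t) \is a fin_num by exact: fin_num_measure.
  move: (private_law f0 Rz xs (A t)) (private_law f1 Rz xs (A t)) fin0 fin1 PA.
  move=> [x| |] [y| |]// _ _.
  by rewrite -!EFinD !lee_fin /c => ?; lra.
- move=> t w Aw; apply: le_trans (KL0 t _); rewrite lee_fin.
  by have : (g t w <= kappa)%R := Aw; rewrite /g; lra.
- move=> t w /= /negP; rewrite -ltNge => Aw.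
  by apply: le_trans (KL1 t _); rewrite lee_fin ltW.
Qed.

Lemma worst_case_ge_half (F : 'I_K -> feature R d -> label_dist R M) i j b :
  (b + b)%:E <= KL_risk (F i) Rz Phi xs + KL_risk (F j) Rz Phi xs ->
  b%:E <= worst_case_KL_risk F Rz Phi.
Proof.
have sup k : KL_risk (F k) Rz Phi xs <= worst_case_KL_risk F Rz Phi.
  by apply: ereal_sup_ubound; exists k => //; exists xs.
move=> bb; rewrite leNgt; apply/negP => wb.
move: bb; rewrite leNgt => /negP; apply; rewrite EFinD.
by apply: lteD; apply: le_lt_trans (sup _) wb.
Qed.

End two_point.

(** * The class of hidden-label distributions *)

Section numerics.
Variable R : realType.
Implicit Types eps : R.

(** Factorwise [1 + x <= exp x]; it turns a bound on the summed divergences into one on the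
    tensorized constant. *)
Lemma prod_le_expR n (C : 'I_n -> R) : (forall i, 0 <= C i) ->
  \prod_i C i <= expR (\sum_i (C i - 1)).
Proof.
move=> C0; rewrite expR_sum; apply: ler_prod => i _.
by rewrite C0/=; have := expR_ge1Dx (C i - 1); rewrite addrC subrK.
Qed.

Lemma expR_quarter_le : expR (1 / 4) <= 4 / 3 :> R.
Proof.
have h : 3 / 4 <= expR (- (1 / 4)) :> R.
  by apply: le_trans (expR_ge1Dx _); lra.
rewrite -[leLHS]invrK -expRN.
have -> : 4 / 3 = (3 / 4)^-1 :> R by field.
by rewrite lef_pV2// posrE ?expR_gt0//; lra.
Qed.

Lemma privacy_factor_gt0 eps : 0 < eps -> 0 < privacy_factor eps.
Proof.
move=> eps0; have e1 : 1 < expR eps by rewrite expR_gt1.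
by rewrite mulr_gt0 ?expR_gt0// lt_min ltr01 andbT exprn_gt0// subr_gt0.
Qed.

(** The left side is [(e - 1) ^ 2 / e] with [e = expR eps]; the two branches of the minimum use
    [e ^ 2 >= 1] and [(e - 1) ^ 2 <= e ^ 2]. *)
Lemma chi2_le_privacy_factor eps : 0 < eps ->
  expR eps + expR (- eps) - 2 <= privacy_factor eps.
Proof.
move=> eps0; rewrite /privacy_factor expRN.
have e1 : 1 < expR eps by rewrite expR_gt1.
set e := expR eps in e1 *; have e0 : 0 < e by lra.
have -> : e + e^-1 - 2 = (e - 1) ^+ 2 / e by field; rewrite gt_eqF.
rewrite ler_pdivrMr// -mulrA.
have ee : 1 <= e * e by nra.
rewrite minEle; case: ifP => _; first by rewrite ler_peMr// sqr_ge0.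
by rewrite mul1r expr2; nra.
Qed.

(** From [e (1 - eps) <= 1] and [eps < 1 / 2] come [e <= 2] and [e - 1 <= 2 eps], so the factor is
    at most [8 eps ^ 2]. *)
Lemma privacy_factor_le_sqr eps : 0 < eps -> eps < 1 / 2 ->
  privacy_factor eps <= (3 * eps) ^+ 2.
Proof.
move=> eps0 eps1; rewrite /privacy_factor.
have e1 : 1 < expR eps by rewrite expR_gt1.
have le_e : expR eps * (1 - eps) <= 1.
  rewrite [leRHS](_ : 1 = expR eps * expR (- eps)); last first.
    by rewrite -expRD subrr expR0.
  by rewrite ler_wpM2l ?expR_ge0//; exact: expR_ge1Dx.
set e := expR eps in e1 le_e *.
have e2 : e <= 2 by nra.
have e3 : e - 1 <= 2 * eps by nra.
apply: (@le_trans _ _ ((e - 1) ^+ 2 * e)).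
  by apply: ler_wpM2r; [lra|rewrite ge_min lexx].
apply: (@le_trans _ _ ((2 * eps) ^+ 2 * 2)).
  apply: ler_pM => //; [exact: sqr_ge0|lra|].
  by rewrite !expr2; nra.
by have := sqr_ge0 eps; rewrite !exprMn; lra.
Qed.

End numerics.

(** * Construction of the class and lower bound on its risk *)

Section hidden_label_class.
Context (R : realType) (d K N : nat) (i0 : 'I_d) (z : 'I_N).
Variable H : 'I_N -> 'I_N -> R.
Hypothesis N1 : (1 < N)%N.
Hypothesis Hz0 : forall y, H z y = 0.
Hypothesis H_sign : forall j y, j != z -> H j y = 1 \/ H j y = -1.
Hypothesis Hz1 : forall j, j != z -> H j z = 1.
Hypothesis H_orth : forall j k, j != k -> \sum_y H j y * H k y = 0.
Hypothesis H_sum0 : forall j, \sum_y H j y = 0.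
Hypothesis H_gram : forall y y',
  \sum_j H j y * H j y' = (N * (y == y'))%:R - 1.

(** Lets a feature encode any amplitude in [0, 1] while every feature still yields a
    distribution. *)
Let clamp (x : 'rV[R]_d) : R := Num.max 0 (Num.min 1 (x 0 i0)).

Let clamp_const (a : R) : 0 <= a <= 1 -> clamp (const_mx a) = a.
Proof. by move=> /andP[a0 a1]; rewrite /clamp mxE min_r// max_r. Qed.

(* The indices [i >= N] only pad the class to [K] distinct functions. *)
Let weight (i : 'I_K) (x : 'rV[R]_d) : R :=
  if (i < N)%N then clamp x else i.+1%:R^-1.

(** Injectivity is tested at two features: amplitude 0 separates the padding functions from each
    other and from the first [N], amplitude 1 separates the rows of [H]. *)
Lemma hidden_label_class : exists F : 'I_K -> 'rV[R]_d -> label_dist R N,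
  injective F /\
  forall (i : 'I_K) (j : 'I_N), i = j :> nat ->
  forall a : R, 0 <= a <= 1 -> forall y, F i (const_mx a) y =
    (1 - a) * (y == z)%:R + a / N%:R * (1 + H j y).
Proof.
have weight01 i x : 0 <= weight i x <= 1.
  rewrite /weight; case: ifP => _.
    by rewrite le_max lexx/= ge_max ler01 ge_min lexx.
  by rewrite invr_ge0 ler0n/= invf_le1// ler1n.
have H_ge j y : -1 <= H j y.
  have [->|jz] := eqVneq j z; first by rewrite Hz0; lra.
  by case: (H_sign y jz) => ->; lra.
(* For a padding index [insubd] defaults to [z], i.e. to the zero row. *)
have /choice[F0 F0E] (ix : 'I_K * 'rV[R]_d) :=
  hidden_label_dist z (weight01 ix.1 ix.2) (H_ge (insubd z (ix.1 : nat)))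
    (H_sum0 _).
exists (fun i x => F0 (i, x)); split; last first.
  move=> i j ij a a01 y; rewrite F0E/= /weight ij ltn_ord clamp_const//.
  by rewrite valKd.
have N0 : N%:R != 0 :> R by rewrite pnatr_eq0 -lt0n ltnW.
have NN1 : 1 - N%:R^-1 != 0 :> R.
  by rewrite subr_eq0 eq_sym invr_eq1 pnatr_eq1 gtn_eqF.
move=> i i' FF.
have FE x : F0 (i, x) = F0 (i', x) by have := congr1 (@^~ x) FF.
(* At the zero feature the mass of label [z] determines the weight, because [N > 1]. *)
have weight0 : weight i (const_mx 0) = weight i' (const_mx 0).
  have F0z k : F0 (k, const_mx 0) z = 1 - weight k (const_mx 0) * (1 - N%:R^-1).
    rewrite F0E/= eqxx mulr1 /weight; case: ifPn => kN.
      by rewrite clamp_const ?lexx ?ler01// !mul0r addr0 !subr0.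
    by rewrite /insubd insubN// Hz0; ring.
  have := F0z i'; rewrite -FE F0z => /addrI/oppr_inj.
  exact: mulIf.
have clamp0 : clamp (const_mx 0) = 0 by rewrite clamp_const ?lexx ?ler01.
have invS_neq0 (k : nat) : k.+1%:R^-1 != 0 :> R by rewrite invr_eq0 pnatr_eq0.
move: weight0; rewrite /weight clamp0.
case: ifPn => iN; case: ifPn => i'N.
- move=> _; have [r|] := eqVneq (insubd z (i : nat)) (insubd z (i' : nat)).
    by apply: val_inj; have := congr1 val r; rewrite !val_insubd iN i'N. 
  set r := insubd z (i : nat); set r' := insubd z (i' : nat) => rr'.
  (* Equal laws at amplitude 1 force equal rows. Row [z] cannot equal another one, by the values at
     [z]; two equal sign rows would have inner product [N], against orthogonality. *)
  have Hrr' y : H r y = H r' y.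
    have c1 : clamp (const_mx 1) = 1 by rewrite clamp_const ?lexx ?ler01.
    have := F0E (i', const_mx 1) y; rewrite -FE F0E /weight/= iN i'N c1 => /addrI.
    by move=> /mulfI; rewrite mul1r invr_eq0 => /(_ N0)/addrI.
  have rz : r != z.
    apply/eqP => rz; have := Hrr' z; rewrite rz Hz0 Hz1; last by rewrite -rz eq_sym.
    by move=> /eqP; rewrite eq_sym oner_eq0.
  have := H_orth rr'; rewrite (eq_bigr (fun=> 1)) => [|y _].
    by rewrite sumr_const card_ord => /eqP; rewrite (negbTE N0).
  by rewrite -Hrr'; case: (H_sign y rz) => ->; rewrite ?mulr1// mulrNN mulr1.
- by move=> h; move: (invS_neq0 i'); rewrite -h eqxx.
- by move=> h; move: (invS_neq0 i); rewrite h eqxx.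
- by move=> /invr_inj/eqP; rewrite eqr_nat eqSS => /eqP/val_inj.
Qed.

(** Nature repeats one feature of amplitude [a]; the divergence budget yields a row that is hard to
    tell from the base law, and Le Cam's method is applied to this pair. *)
Lemma class_risk_ge (F : 'I_K -> 'rV[R]_d -> label_dist R N) (eps : R) (T : nat)
    (Rz : privatization R d K N T) (Phi : prediction R d K N T) :
  (N <= K < 2 * N)%N -> 0 < eps ->
  (forall (i : 'I_K) (j : 'I_N), i = j :> nat ->
   forall a : R, 0 <= a <= 1 -> forall y, F i (const_mx a) y =
    (1 - a) * (y == z)%:R + a / N%:R * (1 + H j y)) ->
  K%:R / (9%:R * privacy_factor eps) <= T%:R ->
  locally_private eps 0 Rz ->
  ((ln 2 / 48 * Num.sqrt (K%:R * T%:R / privacy_factor eps))%:E <=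
    worst_case_KL_risk F Rz Phi)%E.
Proof.
move=> /andP[NK K2N] eps0 FE KT Rz_private.
have pf0 := privacy_factor_gt0 eps0.
set pf := privacy_factor eps in pf0 KT *.
have K0 : 0 < K%:R :> R by rewrite ltr0n (leq_trans _ NK)// ltnW.
have T0 : 0 < T%:R :> R.
  by apply: lt_le_trans KT; rewrite divr_gt0// mulr_gt0.
set root := Num.sqrt _.
have root0 : 0 <= root by exact: sqrtr_ge0.
have root2 : root ^+ 2 = K%:R * T%:R / pf.
  by rewrite sqr_sqrtr//; apply: divr_ge0; [apply: mulr_ge0; exact: ltW|exact: ltW].
(* This is [sqrt (K / (T pf)) / 4], which makes the total budget [K / 16]. *)
pose a := root / (4 * T%:R).
have a0 : 0 <= a by rewrite divr_ge0// mulr_ge0// ltW.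
have a2 : a ^+ 2 * T%:R * pf = K%:R / 16.
  by rewrite /a expr_div_n root2; field; rewrite !gt_eqF.
(* The lower bound on the horizon gives [a ^ 2 <= 9 / 16]. *)
have a1 : a <= 1.
  rewrite -(@ler_pXn2r _ 2) ?nnegrE// expr1n.
  have : K%:R <= T%:R * (9 * pf) by rewrite -ler_pdivrMr// mulr_gt0.
  have Tpf : 0 < T%:R * pf by rewrite mulr_gt0.
  move=> h; rewrite -(ler_pM2r Tpf) mul1r mulrA a2; lra.
have a01 : 0 <= a <= 1 by rewrite a0.
pose x : 'rV[R]_d := const_mx a.
pose xs : T.-tuple 'rV[R]_d := nseq_tuple T x.
have xsE t : tnth xs t = x by rewrite tnth_nseq.
pose f (j : 'I_N) := F (widen_ord NK j).
have fE j y : f j x y = (1 - a) * (y == z)%:R + a / N%:R * (1 + H j y).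
  exact: FE.
have fzE j y : f j x y = f z x y + a / N%:R * H j y.
  by rewrite !fE Hz0; ring.
have /choice[C CP] t := @private_code_budget _ _ _ _ (Rz t x) eps (a / N%:R) H
  (fun j => f j x) (f z x)
  (fun y y' A mA => ltac:(by have := Rz_private t x y y' A mA; rewrite adde0))
  H_sum0 H_gram fzE.
have N0 : N%:R != 0 :> R by rewrite pnatr_eq0 -lt0n ltnW.
have budget : \sum_j \sum_t (C t j - 1) <= K%:R / 16.
  rewrite exchange_big/= -a2.
  apply: (@le_trans _ _ (\sum_(t < T) a ^+ 2 * pf)).
    apply: ler_sum => t _; have [_] := CP t; move/le_trans; apply.
    rewrite divfK//; apply: ler_wpM2l; first exact: sqr_ge0.
    exact: chi2_le_privacy_factor.
  by rewrite sumr_const card_ord -[leLHS]mulr_natl mulrCA mulrA.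
(* Pigeonhole: otherwise the [N - 1] nontrivial rows would use at least
   [(N - 1) / 4 >= N / 8 > K / 16], while row [z] contributes a nonnegative amount. *)
have [j jz Cj] : exists2 j, j != z & \sum_t (C t j - 1) <= 1 / 4.
  apply/not_exists2P => noj.
  have Cz : 0 <= \sum_t (C t z - 1).
    apply: sumr_ge0 => t _; rewrite subr_ge0.
    by have [/(_ z)[_ /sqr_dominated_ge1]] := CP t.
  have : \sum_(j | j != z) (1 / 4) <= \sum_(j | j != z) \sum_t (C t j - 1).
    apply: ler_sum => j jz; have [] := noj j => // /negP.
    by rewrite -ltNge => /ltW.
  move: budget; rewrite (bigD1 z)//= sumr_const.
  have -> : #|[pred j | j != z]| = N.-1.
    by have := cardC1 z; rewrite card_ord.
  have : K%:R < 2 * N%:R :> R by rewrite -natrM ltr_nat.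
  have : 2 <= N%:R :> R by rewrite ler_nat.
  rewrite -[in X in _ -> _ -> _ -> X](mulr_natl _ N.-1).
  have -> : N.-1%:R = N%:R - 1 :> R by rewrite -subn1 natrB// ltnW.
  move: (\sum_(j | j != z) _) => S; lra.
have C0 t : 0 <= C t j by have [/(_ j)[/ltW]] := CP t.
have prodC : \prod_t C t j <= 4 / 3.
  apply: le_trans (prod_le_expR C0) _.
  by apply: le_trans _ (expR_quarter_le R); rewrite ler_expR.
have ln2 : 0 <= ln 2 :> R by rewrite ln_ge0// ler1n.
(* Half of the total loss [a ln 2 / 2] that the two laws share on any guess. *)
pose kappa := a * ln 2 / 4.
have kappa0 : 0 <= kappa by rewrite divr_ge0// mulr_ge0.
apply: (@worst_case_ge_half _ _ _ _ _ Rz Phi xs F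
  (widen_ord NK z) (widen_ord NK j)).
apply: (@le_trans _ _ (kappa * T%:R * (1 - (\prod_t C t j) / 4))%:E).
  rewrite lee_fin.
  (* The factor [2 / 3] is [1 - (4 / 3) / 4], with [4 / 3] the bound on the product. *)
  have -> : ln 2 / 48 * root + ln 2 / 48 * root = kappa * T%:R * (2 / 3).
    by rewrite /kappa /a; field; rewrite gt_eqF.
  by apply: ler_wpM2l; [rewrite mulr_ge0// ltW|lra].
apply: (@two_point_risk _ _ _ _ _ Rz Phi xs _ _ (fun t => C t j)
  (fun y => (1 - H j y) / 2)) => //.
- by move=> t; rewrite xsE; have [/(_ j)[]] := CP t.
- move=> t q; rewrite xsE.
  have -> : 2 * kappa = a / 2 * ln 2 by rewrite /kappa; field.
  apply: (KL_base_ge (z := z) _ (Hz1 jz) (H_sum0 j)) => y; first exact: H_sign.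
  by rewrite [LHS]fE Hz0 addr0 mulr1.
- move=> t q; rewrite xsE.
  by apply: (KL_code_ge (z := z) _ (Hz1 jz)) => y; [exact: H_sign|exact: fE].
Qed.

End hidden_label_class.

(** * Choice of the constants and conclusion *)

Theorem theorem1 (R : realType) :
  exists c eps0 c' : R, 0 < c /\ 0 < eps0 /\ 0 < c' /\
  forall d : nat, (1 <= d)%N ->
  forall eps : R, 0 < eps ->
  forall K : nat, (2 <= K)%N ->
  exists (M : nat) (F : 'I_K -> 'rV[R]_d -> label_dist R M),
    (M <= K)%N /\ injective F /\
    forall T : nat, K%:R / (9%:R * privacy_factor eps) <= T%:R ->
      let bound := c * Num.sqrt (K%:R * T%:R / privacy_factor eps) in
      (forall (Rz : privatization R d K M T) (Phi : prediction R d K M T),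
         locally_private eps 0 Rz ->
         (bound%:E <= worst_case_KL_risk F Rz Phi)%E) /\
      (bound%:E <= minimax_KL_risk T eps 0 F)%E /\
      (eps < eps0 -> c' * (eps^-1 * Num.sqrt (K%:R * T%:R)) <= bound).
Proof.
have ln2 : 0 < ln 2 :> R by rewrite ln_gt0// ltr1n.
(* The threshold [1 / 2] and the divisor 3 come from [sqrt (privacy_factor eps) <= 3 eps] for
   [eps < 1 / 2]. *)
exists (ln 2 / 48), (1 / 2), (ln 2 / 48 / 3).
do 3 (split; first lra).
move=> d d1 eps eps0 K K2.
pose m := trunc_log 2 K.
have /andP[NK KN] : (2 ^ m <= K < 2 ^ m.+1)%N by apply: trunc_log_bounds => //; exact: ltnW.
have m1 : (1 < 2 ^ m)%N by rewrite -[1%N](expn0 2) ltn_exp2l// trunc_log_gt0.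
have [H [z [Hz0 H_sign Hz1 H_orth [H_sum0 H_gram]]]] := walsh_code R m.
have [F [F_inj FE]] :=
  @hidden_label_class R d K (2 ^ m) (Ordinal d1) z H m1 Hz0 H_sign Hz1 H_orth H_sum0.
exists (2 ^ m)%N, F; split=> //; split=> // T KT bound.
have worst (Rz : privatization R d K (2 ^ m) T) Phi : locally_private eps 0 Rz ->
    (bound%:E <= worst_case_KL_risk F Rz Phi)%E.
  move=> RzP; rewrite /bound.
  have NK2 : (2 ^ m <= K < 2 * 2 ^ m)%N by rewrite NK -expnS.
  exact: (class_risk_ge m1 Hz0 H_sign Hz1 H_sum0 H_gram Phi NK2 eps0 FE KT RzP).
split=> //; split.
  by apply: le_ereal_inf_tmp => _ [Rz RzP [Phi _ <-]]; exact: worst.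
move=> eps1; rewrite /bound -[leLHS]mulrA ler_pM2l; last lra.
have KT0 : 0 <= K%:R * T%:R :> R by rewrite mulr_ge0.
rewrite [Num.sqrt (_ / _)]sqrtrM// [leLHS]mulrA [leLHS]mulrC; apply: ler_wpM2l; first exact: sqrtr_ge0.
have pf0 := privacy_factor_gt0 eps0.
have -> : 3^-1 * eps^-1 = (3 * eps)^-1 by rewrite invfM.
have e3 : 0 < 3 * eps by lra.
rewrite -[leLHS](ger0_norm (ltW _)) ?invr_gt0// -sqrtr_sqr ler_wsqrtr//.
rewrite exprVn lef_pV2 ?posrE ?exprn_gt0//.
exact: privacy_factor_le_sqr.
Qed.
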